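(* Suppose that $\Phi$ is an independently marked renewal process with exponentially distributed failure marks, i.e. $\mathbb{P}^0[L_{0,1}\le x]=1-e^{-\lambda x}$ for $x\ge 0$, for some $\lambda>0$, satisfying the assumptions in the context, and assume $\mathbb{E}^0[\nu_1]<\infty$. Then, $\mathbb{P}^0$-a.s., there exists an infinite sequence of universal checkpoints.
   Context: Let $\mathbb{R}^+=[0,\infty)$. $\Phi=\{(X_n,\mathbf{L}_n)\}_{n\in\mathbb{Z}}$ is a stationary simple marked point process on $\mathbb{R}$ with finite positive intensity, $X_n<X_{n+1}$, and marks $\mathbf{L}_n=\{L_{n,i}\}_{i\ge1}\in(\mathbb{R}^+)^{\mathbb{N}}$; $\mathbb{P}^0$ (expectation $\mathbb{E}^0$) is its Palm probability, so $X_0=0$ $\mathbb{P}^0$-a.s. Put $D_n=X_{n+1}-X_n$. Assumptions under $\mathbb{P}^0$: $\{D_n\}_{n\in\mathbb{Z}}$ is i.i.d.; for each $n$, $\{L_{n,i}\}_{i\ge1}$ is i.i.d.; the process is independently marked, i.e. the marks $\{\mathbf{L}_n\}$ are i.i.d. in $n$ and independent of $\{D_n\}$; $D_0$ and $L_{0,1}$ have right-unbounded support and finite expectation. For $n\in\mathbb{Z}$: $\tau_n=\inf\{k\ge1:L_{n,k}>D_n\}$, $Z_n=L_{n,\tau_n}-D_n$. Set $\nu_{-1}=0$ and, for $n\ge0$, $\nu_n=\sup\{k\ge\nu_{n-1}+1: Z_{\nu_{n-1}}>X_k-X_{\nu_{n-1}+1}\}$. For $n\in\mathbb{Z}$ let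 $\kappa_n=\sup\{k\ge n: L_{n,\tau_n}\ge X_k-X_n\}$ and $S_C(\Phi,X_n)=X_{\kappa_n}$ (the next checkpoint secured when starting from $X_n$); $S_C^j$ denotes the $j$-th iterate: $S_C^1=S_C$, $S_C^{j+1}(\Phi,X_n)=S_C(\Phi,S_C^{j}(\Phi,X_n))$. A point $X_m$ is a universal checkpoint if for all $k<m$ there exists $j\ge1$ such that $S_C^j(\Phi,X_k)=X_m$. *)

(* Defs.v *)
From HB Require Import structures.
From mathcomp Require Import all_boot all_order all_algebra.
From mathcomp Require Import finmap.
From mathcomp Require Import all_classical all_reals all_analysis.

Set Implicit Arguments.
Unset Strict Implicit.
Unset Printing Implicit Defensive.

Import Order.TTheory GRing.Theory Num.Theory.
Import numFieldNormedType.Exports.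

Local Open Scope classical_set_scope.
Local Open Scope ring_scope.
Local Open Scope ereal_scope.

(* A realization of the marked point process is a pair (x, l): x n is the
   n-th point and l n its sequence of marks. Mark sequences are indexed from 0,
   i.e. l n i stands for the mark L_{n,i+1}, and tau is shifted accordingly. *)

Definition gap (R : realType) (x : int -> R) (n : int) : R :=
  (x (n + 1) - x n)%R.

(* The library's infimum and supremum take as first argument a default value,
   returned when no infimum (resp. supremum) exists. The default for tau only
   matters on the event that no mark of x n exceeds the gap, the one for
   nu_step when the excess at j is not positive. *)
Definition tau (R : realType) (x : int -> R) (l : int -> nat -> R)
    (n : int) : nat :=
  infimum 0%N [set i : nat | (gap x n < l n i)%R].

Definition excess (R : realType) (x : int -> R) (l : int -> nat -> R)
    (n : int) : R :=
  (l n (tau x l n) - gap x n)%R.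

Definition nu_step (R : realType) (x : int -> R) (l : int -> nat -> R)
    (j : int) : int :=
  supremum 0%R [set k : int | (j + 1 <= k)%R /\
                              (x k - x (j + 1) < excess x l j)%R].

(* nu_n, with nu_{-1} = 0 as the starting point of the iteration. *)
Definition nu (R : realType) (x : int -> R) (l : int -> nat -> R)
    (n : nat) : int :=
  iter n.+1 (nu_step x l) 0%R.

Definition kappa (R : realType) (x : int -> R) (l : int -> nat -> R)
    (n : int) : int :=
  supremum 0%R [set k : int | (n <= k)%R /\
                              (x k - x n <= l n (tau x l n))%R].

Definition point_index (R : realType) (x : int -> R) (y : R) : int :=
  xget 0%R [set n : int | x n = y].

Definition next_checkpoint (R : realType) (x : int -> R) (l : int -> nat -> R)
    (y : R) : R :=
  x (kappa x l (point_index x y)).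

Definition universal_checkpoint (R : realType) (x : int -> R)
    (l : int -> nat -> R) (m : int) : Prop :=
  forall k : int, (k < m)%R ->
    exists2 j : nat, (1 <= j)%N & iter j (next_checkpoint x l) (x k) = x m.

(* Stationarity is expressed with a measurable flow theta on the probability
   space that preserves P and shifts the process: the points and marks of
   theta_t w are those of w, translated by -t. The normalization
   X_0 <= 0 < X_1 determines the renumbering k. *)
Record stationary_marked_point_process (d : measure_display)
    (T : measurableType d) (R : realType) (P : probability T R)
    (theta : R -> T -> T) (X : int -> T -> R) (L : int -> nat -> T -> R) :
    Prop := {
  flow_measurable : measurable_fun setT (fun p : R * T => theta p.1 p.2);
  flow0 : forall w, theta 0%R w = w;
  flowD : forall s t w, theta (s + t)%R w = theta s (theta t w);
  flow_preserves : forall t (A : set T), measurable A ->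
    P (theta t @^-1` A) = P A;
  point_measurable : forall n, measurable_fun setT (X n);
  mark_measurable : forall n i, measurable_fun setT (L n i);
  mark_ge0 : forall n i w, (0 <= L n i w)%R;
  points_increasing : forall n w, (X n w < X (n + 1) w)%R;
  points_normalized : forall w, (X 0 w <= 0 < X 1 w)%R;
  points_unbounded : forall w (M : R),
    (exists n, M < X n w)%R /\ (exists n, X n w < M)%R;
  flow_shift : forall t w, exists k : int, forall n,
    X n (theta t w) = (X (n + k) w - t)%R /\
    forall i, L n i (theta t w) = L (n + k)%R i w
}.

Definition intensity (d : measure_display) (T : measurableType d)
    (R : realType) (P : probability T R) (X : int -> T -> R) : \bar R :=
  \int[P]_w \esum_(n in [set n : int | (0 < X n w <= 1)%R]) 1.

Definition is_palm_probability (d : measure_display) (T : measurableType d)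
    (R : realType) (P : probability T R) (theta : R -> T -> T)
    (X : int -> T -> R) (P0 : probability T R) : Prop :=
  forall A : set T, measurable A ->
    intensity P X * P0 A =
    \int[P]_w \esum_(n in [set n : int | (0 < X n w <= 1)%R])
      (\1_A (theta (X n w) w))%:E.

Definition independent_systems (d : measure_display) (T : measurableType d)
    (R : realType) (P : probability T R) (I : choiceType)
    (F : I -> set (set T)) : Prop :=
  forall (J : {fset I}) (A : I -> set T), (forall j, j \in J -> F j (A j)) ->
    P (\bigcap_(j in [set` J]) A j) = \prod_(j <- J) P (A j).

Definition sigma_generated (S : Type) (R : realType) (J : Type)
    (Y : J -> S -> R) : set (set S) :=
  <<s \bigcup_j preimage_set_system setT (Y j) measurable >>.

Definition iid_variables (d : measure_display) (T : measurableType d)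
    (R : realType) (P : probability T R) (I : choiceType)
    (Y : I -> T -> R) : Prop :=
  independent_systems P
    (fun i => preimage_set_system setT (Y i) measurable) /\
  forall i i' (B : set R), measurable B -> P (Y i @^-1` B) = P (Y i' @^-1` B).

(* Here each Y i is a random element of R^nat, with the product
   sigma-algebra, i.e. the one generated by the coordinates. *)
Definition iid_sequences (d : measure_display) (T : measurableType d)
    (R : realType) (P : probability T R) (I : choiceType)
    (Y : I -> nat -> T -> R) : Prop :=
  independent_systems P (fun i => sigma_generated (Y i)) /\
  forall i i' (C : set (nat -> R)),
    sigma_generated (fun (j : nat) (f : nat -> R) => f j) C ->
    P [set w | C (fun j => Y i j w)] = P [set w | C (fun j => Y i' j w)].

Definition independent_families (d : measure_display) (T : measurableType d)
    (R : realType) (P : probability T R) (J K : Type)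
    (Y : J -> T -> R) (Z : K -> T -> R) : Prop :=
  forall A B : set T, sigma_generated Y A -> sigma_generated Z B ->
    P (A `&` B) = P A * P B.

Definition law_support (d : measure_display) (T : measurableType d)
    (R : realType) (P : probability T R) (Y : T -> R) : set R :=
  [set y | forall e : R, (0 < e)%R -> 0 < P [set w | (`|Y w - y| < e)%R]].

Definition right_unbounded_support (d : measure_display)
    (T : measurableType d) (R : realType) (P : probability T R)
    (Y : T -> R) : Prop :=
  ~ has_ubound (law_support P Y).

(* Main.v *)
Require Import Defs.
From HB Require Import structures.
From mathcomp Require Import all_boot all_order all_algebra.
From mathcomp Require Import finmap.
From mathcomp Require Import all_classical all_reals all_analysis.
From mathcomp Require Import measurable_realfun.
From mathcomp Require Import ring lra zify.
Import Order.TTheory GRing.Theory Num.Theory.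
Import numFieldNormedType.Exports.
Local Open Scope classical_set_scope.
Local Open Scope ring_scope.

Set Implicit Arguments.
Unset Strict Implicit.
Unset Printing Implicit Defensive.

(** Write D k for the gap following the point k, and Z k for the excess over D k
of the first mark at k that is longer than D k. The checkpoint secured from k
lies beyond m exactly when Z k >= D (k+1) + .. + D m; say then that k jumps over
m. Checkpoints move strictly to the right, so a point m over which no k < m
jumps is a universal checkpoint: a trajectory started before m can neither pass
over m nor stay before it (universal_checkpoint_unjumped). Almost surely there
are such points arbitrarily far to the right. The proof is a direct estimate, in
which two exponential rates compete.

- Far jumps are rare. An exponential mark that exceeds D k overshoots it by an
  exponential amount, so Z k has an exponential tail, whereas D (k+1) + .. + D m
  is at least the number of gaps among these that are longer than 1. Summing
  over the possible sets of long gaps, k jumps over m with probability at most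
  e^lambda * decay ^ (m - k), where decay < 1 (prob_jump). Hence m is jumped
  over from more than r steps away with probability at most C * decay ^ r
  (prob_jumped_from_afar).

- Near jumps are prevented by an event that is not too unlikely. If the gap at m
  is longer than c, and at each of the r points before m the first mark longer
  than the gap is at most c, then none of these points jumps over m. As the
  points are independent, this has probability q * w ^ r, and the thresholds can
  be chosen so that w > decay (exists_calm).

For disjoint blocks of r+1 consecutive points these latter events are
independent. Among N blocks, none is successful with probability
(1 - q * w ^ r) ^ N (prob_no_full_block), and far jumps spoil some block with
probability at most N * C * decay ^ r. Because decay < w, taking r large and
then N a large multiple of 1 / (q * w ^ r) makes both terms small
(exists_trials). Thus, with probability one, not all points to the right of a
given place are jumped over.

The excess mixes gaps and marks. To compute probabilities with the independence
hypotheses alone, D k is enclosed between consecutive integers, or compared with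
a fixed threshold; every event then becomes a union of intersections of a gap
event with a mark event, and those intersections have product probabilities. *)

(** * A pathwise criterion for universal checkpoints *)

Lemma supremum_max {disp : Order.disp_t} {T : porderType disp} (x0 : T)
  (A : set T) (k : T) : A k -> ubound A k -> supremum x0 A = k.
Proof.
move=> Ak Aub; rewrite /supremum ifF; last first.
  by apply/negbTE/set0P; exists k.
have : supremums A k by split => // y; apply.
by move=> Sk; apply: xget_unique => // y [Ay lby]; apply/eqP;
  rewrite eq_le lby// Ay.
Qed.

Lemma infimum_min {disp : Order.disp_t} {T : porderType disp} (x0 : T)
  (A : set T) (k : T) : A k -> lbound A k -> infimum x0 A = k.
Proof.
move=> Ak Alb; rewrite /infimum ifF; last first.
  by apply/negbTE/set0P; exists k.
have : infimums A k by split => // y; apply.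
by move=> Sk; apply: xget_unique => // y [Ay uby]; apply/eqP;
  rewrite eq_le uby// Ay.
Qed.

Section realization.
Context {R : realType}.
Implicit Types (x : int -> R) (l : int -> nat -> R).

Lemma tauP x l n : (exists i, gap x n < l n i) ->
  gap x n < l n (tau x l n) /\ forall i, (i < tau x l n)%N -> l n i <= gap x n.
Proof.
move=> ex; case: (ex_minnP ex) => i0 hi0 mini0.
have -> : tau x l n = i0.
  by apply: infimum_min => // i /= hi; apply: mini0.
split=> // i ilt; rewrite leNgt; apply/negP => /mini0.
by rewrite leqNgt ilt.
Qed.

Lemma points_lt x : (forall n, x n < x (n + 1)) -> {homo x : m n / m < n}.
Proof.
move=> xS m n mn.
have [j ->] : exists j : nat, n = m + j.+1%:Z by exists (`|n - m|%N.-1); lia.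
elim: j {n mn} => [|j IH]; first exact: xS.
by apply: (lt_trans IH); rewrite (_ : j.+2%:Z = j.+1%:Z + 1) ?addrA//; lia.
Qed.

(** The indices in the supremum that defines kappa include k+1, because the mark
exceeds the gap, and exclude m+1, because of the bound on the excess. *)
Lemma kappa_bounds x l k m :
  (forall n, x n < x (n + 1)) -> (forall M, exists n, M < x n) ->
  gap x k < l k (tau x l k) -> k < m ->
  excess x l k < x (m + 1) - x (k + 1) -> k < kappa x l k <= m.
Proof.
move=> xS xub; rewrite /excess /gap; set t := l k _ => kt km zm.
have xlt := points_lt xS; have xle := ltW_homo xlt.
pose P (j : nat) := x (k + j%:Z) - x k <= t.
have exP : exists j, P j by exists 1%N; rewrite /P ltW.
have Pub j : P j -> (j <= `|m - k|)%N.
  rewrite /P leqNgt => Pj; apply/negP => jm.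
  have : x (m + 1) <= x (k + j%:Z) by apply: xle; lia.
  lra.
case: (ex_maxnP exP Pub) => j0 Pj0 maxj0.
have -> : kappa x l k = k + j0%:Z.
  apply: supremum_max => [|n [kn xn]] /=.
    by split; [lia|exact: Pj0].
  rewrite -lerBlDl.
  have : (`|n - k| <= j0)%N.
    by apply: maxj0; rewrite /P (_ : k + `|n - k|%N%:Z = n)//; lia.
  by lia.
have j1 : (1 <= j0)%N by apply: maxj0; rewrite /P ltW.
by have := Pub _ Pj0; lia.
Qed.

Lemma iter_next_checkpoint x l j k : (forall n, x n < x (n + 1)) ->
  iter j (next_checkpoint x l) (x k) = x (iter j (kappa x l) k).
Proof.
move=> xS; elim: j => [//|j IH]; rewrite !iterS IH /next_checkpoint.
have xinj : injective x.
  move=> a b; have /le_mono xle := points_lt xS.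
  by move=> /eqP; rewrite eq_le !xle -eq_le => /eqP.
congr (x (kappa x l _)); apply: xget_unique => //= n /xinj//.
Qed.

(** Iterating from k < m, the index increases strictly and cannot pass m without
stopping at it. *)
Lemma universal_checkpoint_unjumped x l m :
  (forall n, x n < x (n + 1)) -> (forall M, exists n, M < x n) ->
  (forall k, k < m -> exists i, gap x k < l k i) ->
  (forall k, k < m -> excess x l k < x (m + 1) - x (k + 1)) ->
  universal_checkpoint x l m.
Proof.
move=> xS xub hl hex k km.
have hk n : n < m -> n < kappa x l n <= m.
  by move=> nm; apply: kappa_bounds => //; [case: (tauP (hl _ nm))|exact: hex].
suff : exists2 j : nat, (1 <= j)%N & iter j (kappa x l) k = m.
  by case=> j j1 jm; exists j => //; rewrite iter_next_checkpoint// jm.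
have [n] := ubnP `|m - k|%N.
elim: n k km => // n IH k km kn.
have /andP[k1 k2] := hk _ km.
have [e|km'] := eqVneq (kappa x l k) m; first by exists 1%N.
have km2 : kappa x l k < m by rewrite lt_neqAle km' k2.
have [|j j1 jm] := IH _ km2; first lia.
by exists j.+1 => //; rewrite iterSr.
Qed.

End realization.

(** * Elementary estimates *)

Lemma exists_expr_lt {R : realType} (q e : R) :
  0 <= q < 1 -> 0 < e -> exists n : nat, q ^+ n < e.
Proof.
move=> /andP[q0 q1] e0.
have : (GRing.exp q) @ \oo --> (0 : R) by apply: cvg_expr; rewrite ger0_norm.
move=> /cvgrPdist_lt /(_ e e0)[n _ /(_ n)] /= /(_ (leqnn _)).
by rewrite sub0r normrN ger0_norm ?exprn_ge0// => ?; exists n.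
Qed.

Lemma nneseries_le_partial {R : realType} (u : nat -> \bar R) (c : \bar R) :
  (forall i, 0 <= u i)%E -> (forall n, \sum_(0 <= i < n) u i <= c)%E ->
  (\sum_(i <oo) u i <= c)%E.
Proof.
move=> u0 uc; apply: lime_le; first exact: is_cvg_nneseries.
exact: nearW.
Qed.

Lemma geometric_sum_le {R : realType} (p c : R) n : 0 <= p <= 1 -> 0 <= c ->
  \sum_(0 <= i < n) (1 - p) ^+ i * (p * c) <= c.
Proof.
move=> /andP[p0 p1] c0.
have -> : \sum_(0 <= i < n) (1 - p) ^+ i * (p * c) = c * (1 - (1 - p) ^+ n).
  elim: n => [|n IH]; first by rewrite big_nil expr0 subrr mulr0.
  by rewrite big_nat_recr//= IH exprS; ring.
by rewrite ler_piMr// gerBl exprn_ge0// subr_ge0.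
Qed.

(** Bernoulli's inequality. *)
Lemma expr_onem_ge {R : realType} (x : R) n : 0 <= x <= 1 ->
  1 - n%:R * x <= (1 - x) ^+ n.
Proof.
move=> /andP[x0 x1]; elim: n => [|n IH]; first by rewrite mul0r subr0 expr0.
have : (1 - x) * (1 - n%:R * x) <= (1 - x) * (1 - x) ^+ n.
  by rewrite ler_wpM2l// subr_ge0.
rewrite -exprS; apply: le_trans; rewrite -natr1.
have : 0 <= (n%:R : R) * (x * x) by rewrite !mulr_ge0.
lra.
Qed.

(** This division-free form of (1 - x) ^ n <= 1 / (1 + n x) turns many trials of
small success probability x into a small probability of no success. *)
Lemma expr_onem_le {R : realType} (x : R) n : 0 <= x <= 1 ->
  (1 - x) ^+ n * (1 + n%:R * x) <= 1.
Proof.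
move=> /andP[x0 x1]; elim: n => [|n IH]; first by rewrite mul0r addr0 expr0 mul1r.
apply: le_trans IH; rewrite exprSr -mulrA ler_wpM2l ?exprn_ge0 ?subr_ge0//.
rewrite -natr1.
have : 0 <= (n%:R : R) * (x * x) by rewrite !mulr_ge0.
have : 0 <= x * x by rewrite mulr_ge0.
lra.
Qed.

(** Since p < w, the ratio (p / w) ^ r can be made as small as desired; N is then
taken just above 2 / (e * q * w ^ r), which makes the first term at most e / 2
and the second one a constant times (p / w) ^ r. *)
Lemma exists_trials {R : realType} (p w q C e : R) :
  0 <= p -> p < w <= 1 -> 0 < q <= 1 -> 0 <= C -> 0 < e <= 1 ->
  exists r N : nat, (1 - q * w ^+ r) ^+ N + N%:R * (C * p ^+ r) <= e.
Proof.
move=> p0 /andP[pw w1] /andP[q0 q1] C0 /andP[e0 e1].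
have w0 : 0 < w by exact: le_lt_trans pw.
have C1 : 0 < C + 1 by lra.
have pw01 : 0 <= p / w < 1 by rewrite divr_ge0 ?ltr_pdivrMr ?mul1r// ltW.
have g0 : 0 < e ^+ 2 * q / (6 * (C + 1)).
  by rewrite divr_gt0 ?mulr_gt0 ?exprn_gt0.
have [r hr] := exists_expr_lt pw01 g0.
(* x is the success probability of one trial, and y the desired number of trials *)
pose x := q * w ^+ r.
have wr0 : 0 < w ^+ r by rewrite exprn_gt0.
have x0 : 0 < x by rewrite mulr_gt0.
have x1 : x <= 1.
  by rewrite mulr_ile1 ?(ltW q0) ?(ltW wr0)// exprn_ile1 ?(ltW w0).
have ex0 : 0 < e * x by rewrite mulr_gt0.
pose y := 2 / (e * x).
have y0 : 0 <= y by rewrite divr_ge0// ltW.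
have yE : y * (e * x) = 2 by rewrite mulrVK// unitfE gt_eqF.
have /andP[N1 N2] := truncn_itv y0.
exists r, (Num.truncn y).+1; rewrite -/x; set N := (Num.truncn y).+1.
have NyE : y < N%:R by [].
have NeE : N%:R * (e * x) <= 3.
  have : (Num.truncn y)%:R * (e * x) <= y * (e * x) by rewrite ler_wpM2r// ltW.
  have : e * x <= 1 by rewrite mulr_ile1 ?(ltW e0) ?(ltW x0).
  by rewrite /N -natr1 mulrDl mul1r; lra.
have h1 : (1 - x) ^+ N <= e / 2.
  have x01 : 0 <= x <= 1 by rewrite ltW.
  have := expr_onem_le N x01.
  have pN : 0 <= (1 - x) ^+ N by rewrite exprn_ge0// subr_ge0.
  have Ny : 2 <= N%:R * (e * x) by rewrite -yE ler_wpM2r ?(ltW ex0) ?(ltW NyE).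
  have : (1 - x) ^+ N * 2 <= (1 - x) ^+ N * (N%:R * (e * x)).
    by rewrite ler_wpM2l.
  have : 0 <= (1 - x) ^+ N * e by rewrite mulr_ge0// ltW.
  have -> : (1 - x) ^+ N * (N%:R * (e * x)) =
     e * ((1 - x) ^+ N * (1 + N%:R * x)) - (1 - x) ^+ N * e by ring.
  move=> ? ? ?.
  have : e * ((1 - x) ^+ N * (1 + N%:R * x)) <= e * 1 by rewrite ler_wpM2l// ltW.
  lra.
have h2 : N%:R * (C * p ^+ r) <= e / 2.
  have hr' : p ^+ r <= e ^+ 2 * q / (6 * (C + 1)) * w ^+ r.
    by rewrite -ler_pdivrMr// -expr_div_n ltW.
  apply: (@le_trans _ _ (N%:R * ((C + 1) *
      (e ^+ 2 * q / (6 * (C + 1)) * w ^+ r)))).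
    rewrite ler_wpM2l// ler_pM ?exprn_ge0//; lra.
  have -> : N%:R * ((C + 1) * (e ^+ 2 * q / (6 * (C + 1)) * w ^+ r)) =
    (e / 6) * (N%:R * (e * x)).
    by rewrite /x; field; lra.
  have : e / 6 * (N%:R * (e * x)) <= e / 6 * 3 by rewrite ler_wpM2l//; lra.
  lra.
lra.
Qed.

(** * Generated sigma-algebras and independence *)

Section generated.
Context {T : Type} {R : realType} {J : Type} (Y : J -> T -> R).

Lemma sigma_generated_preimage (j : J) (B : set R) : measurable B ->
  sigma_generated Y (Y j @^-1` B).
Proof.
move=> mB; apply: sub_sigma_algebra; exists j => //=.
by exists B => //; rewrite setTI.
Qed.

Lemma sigma_generated_le (j : J) (x : R) :
  sigma_generated Y [set w | Y j w <= x].
Proof.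
by rewrite -preimage_itvNyc; apply: sigma_generated_preimage;
  exact: measurable_itv.
Qed.

Lemma sigma_generated_gt (j : J) (x : R) :
  sigma_generated Y [set w | x < Y j w].
Proof.
by rewrite -preimage_itvoy; apply: sigma_generated_preimage;
  exact: measurable_itv.
Qed.

End generated.

Section generated_measurable.
Context {d : measure_display} {T : measurableType d} {R : realType}.
Context {J : Type} (Y : J -> T -> R).

(** Read from left to right, this makes the closure properties of measurable sets
available for generated sigma-algebras. *)
Lemma sigma_generatedE :
  sigma_generated Y = @measurable _ (g_sigma_algebraType
    (\bigcup_j preimage_set_system setT (Y j) measurable)).
Proof. by []. Qed.

Lemma sigma_generated_measurable (A : set T) :
  (forall j, measurable_fun setT (Y j)) ->
  sigma_generated Y A -> measurable A.
Proof.
move=> mY; apply: smallest_sub; first exact: sigma_algebra_measurable.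
by move=> _ [j _ [B mB <-]]; exact: mY.
Qed.

End generated_measurable.

Lemma preimage_set_system_le {T : Type} {R : realType} (f : T -> R) (x : R) :
  preimage_set_system setT f measurable [set w | f w <= x].
Proof.
exists [set` `]-oo, x]]; first exact: measurable_itv.
by rewrite setTI; exact: preimage_itvNyc.
Qed.

Lemma preimage_set_system_gt {T : Type} {R : realType} (f : T -> R) (x : R) :
  preimage_set_system setT f measurable [set w | x < f w].
Proof.
exists [set` `]x, +oo[]; first exact: measurable_itv.
by rewrite setTI; exact: preimage_itvoy.
Qed.

Section independence.
Context {d : measure_display} {T : measurableType d} {R : realType}.
Variable P : probability T R.

Lemma independent_systems_seq (I : choiceType) (F : I -> set (set T))
    (s : seq I) (A : I -> set T) :
  independent_systems P F -> uniq s -> (forall j, j \in s -> F j (A j)) ->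
  P (\bigcap_(j in [set` s]) A j) = (\prod_(j <- s) P (A j))%E.
Proof.
move=> indF us FA; have := indF [fset j in s]%fset A.
rewrite (_ : [set` [fset j in s]%fset] = [set` s]); last first.
  by apply/seteqP; split => j /=; rewrite !inE.
move=> ->; last by move=> j; rewrite !inE; exact: FA.
apply: perm_big; apply: uniq_perm => // j.
by rewrite !inE.
Qed.

(** The events may be indexed by any type that injects into the index type of the
independent family; blocks of consecutive points are indexed in this way. *)
Lemma independent_systems_inj (I K : choiceType) (F : I -> set (set T))
    (s : seq K) (f : K -> I) (A : K -> set T) :
  independent_systems P F -> uniq s -> injective f ->
  (forall j, j \in s -> F (f j) (A j)) ->
  P (\bigcap_(j in [set` s]) A j) = (\prod_(j <- s) P (A j))%E.
Proof.
move=> indF us finj FA.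
pose A' i := \bigcap_(j in [set j | j \in s /\ f j = i]) A j.
have A'f j : j \in s -> A' (f j) = A j.
  move=> js; apply/seteqP; split => w; first by apply; split.
  by move=> Aw i [_ /finj ->].
have -> : \bigcap_(j in [set` s]) A j = \bigcap_(i in [set` map f s]) A' i.
  apply/seteqP; split => w /= h.
    by move=> i /= /mapP[j js ->]; rewrite A'f//; exact: h.
  by move=> j /= js; rewrite -A'f//; apply: h; apply: map_f.
rewrite (independent_systems_seq indF) ?map_inj_uniq//.
  by rewrite big_map; apply: eq_big_seq => j js; rewrite A'f.
by move=> _ /mapP[j js ->]; rewrite A'f//; exact: FA.
Qed.

Lemma measure_bigcup_seq_le (K : choiceType) (s : seq K) (A : K -> set T) :
  (forall j, measurable (A j)) ->
  (P (\bigcup_(j in [set` s]) A j) <= \sum_(j <- s) P (A j))%E.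
Proof.
move=> mA; rewrite bigcup_seq.
elim: s => [|j s IH]; first by rewrite !big_nil measure0.
rewrite !big_cons; apply: le_trans (leeD2l _ IH).
apply: measureU2 => //; exact: bigsetU_measurable.
Qed.

(** Removing the block n from the event that the first n blocks fail replaces the
set s of required indices, in the second term of
P (A minus B) = P A - P (A and B), by s together with that block. This is why the induction needs an arbitrary s that
lies beyond the blocks considered. *)
Lemma prob_no_full_block (E : nat -> set T) (e : nat -> R) b n (s : seq nat) :
  (forall i, measurable (E i)) ->
  (forall t : seq nat, uniq t ->
    P (\bigcap_(i in [set` t]) E i) = (\prod_(i <- t) e i)%:E) ->
  uniq s -> (forall i, i \in s -> (n * b <= i)%N) ->
  P (\bigcap_(i in [set` s]) E i `&`
     \bigcap_(j in `I_n) ~` \bigcap_(i in [set` iota (j * b) b]) E i) =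
  (\prod_(i <- s) e i *
   \prod_(j < n) (1 - \prod_(i <- iota (j * b) b) e i))%:E.
Proof.
move=> mE indE.
have mB (t : seq nat) : measurable (\bigcap_(i in [set` t]) E i).
  by apply: fin_bigcap_measurable => [|i _]; [exact: finite_seq|exact: mE].
elim: n s => [|n IH] s us sn.
  rewrite II0 bigcap_set0 setIT big_ord0 mulr1; exact: indE.
set N := \bigcap_(j in `I_n) ~` \bigcap_(i in [set` iota (j * b) b]) E i.
have mN : measurable N.
  by apply: bigcap_measurableType => j _; exact: measurableC.
have sn' i : i \in s -> (n * b <= i)%N.
  by move=> /sn; apply: leq_trans; rewrite leq_mul2r leqnSn orbT.
set Wn := \bigcap_(i in [set` iota (n * b) b]) E i.
have -> : (\bigcap_(j in `I_n.+1)
    ~` (\bigcap_(i in [set` iota (j * b) b]) E i)) = N `\` Wn.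
  apply/seteqP; split => w /= h.
    split; last by apply: h => /=; exact: ltnSn.
    by move=> j /= jn; apply: h => /=; exact: ltnW.
  move=> j /=; rewrite ltnS leq_eqVlt => /predU1P[->|jn]; first exact: h.2.
  exact: h.1.
set A := \bigcap_(i in [set` s]) E i.
have mA : measurable (A `&` N) by apply: measurableI => //; exact: mB.
have ANW : A `&` N `&` Wn =
    \bigcap_(i in [set` s ++ iota (n * b) b]) E i `&` N.
  rewrite setIAC (_ : [set` s ++ _] = [set` s] `|` [set` iota (n * b) b]).
    by rewrite bigcap_setU.
  by apply/seteqP; split => i /=; rewrite mem_cat => /orP.
have us' : uniq (s ++ iota (n * b) b).
  rewrite cat_uniq us iota_uniq andbT/=; apply/hasPn => i.
  rewrite mem_iota => /andP[_ ib]; apply/negP => /sn.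
  by rewrite mulSn addnC leqNgt ib.
have sn2 i : i \in s ++ iota (n * b) b -> (n * b <= i)%N.
  by rewrite mem_cat => /orP[/sn'//|]; rewrite mem_iota => /andP[].
rewrite setIDA; apply: (etrans (measureD mA (mB _) _)).
  by rewrite ltey_eq fin_num_measure.
rewrite [X in (_ - P X)%E]ANW.
apply: (etrans (congr2 (fun x y => (x - y)%E) (IH s us sn') (IH _ us' sn2))).
by rewrite -EFinB big_cat big_ord_recr/=; congr EFin; ring.
Qed.

(** Only the covers need to be measurable. This matters for events stated through
checkpoints, whose measurability is thus never examined. *)
Lemma negligible_small_covers (A : set T) :
  (forall e : R, 0 < e <= 1 ->
     exists B, [/\ measurable B, (P B <= e%:E)%E & A `<=` B]) ->
  P.-negligible A.
Proof.
move=> h.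
have : forall n : nat,
    exists B, [/\ measurable B, (P B <= (n.+1%:R^-1)%:E)%E & A `<=` B].
  by move=> n; apply: h; rewrite invr_gt0 ltr0n/= invf_le1// ler1n.
move=> /choice[B hB].
have mB : measurable (\bigcap_n B n).
  by apply: bigcapT_measurable => n; case: (hB n).
exists (\bigcap_n B n); split=> //; last by move=> w Aw n _; case: (hB n); auto.
apply/eqP; rewrite eq_le measure_ge0 andbT; apply/lee_addgt0Pr => e e0.
rewrite add0e; have [n _ ne] := near_infty_natSinv_lt (PosNum e0).
have [mBn Bn _] := hB n.
apply: (@le_trans _ _ (P (B n))).
  by apply: le_measure; rewrite ?inE//; exact: bigcap_inf.
by apply: le_trans Bn _; rewrite lee_fin ltW//; exact: (ne n (leqnn _)).
Qed.

End independence.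

(** * Jumps over many points are exponentially unlikely *)

Section marked.
Context {d : measure_display} {T : measurableType d} {R : realType}.
Variables (P : probability T R) (D : int -> T -> R) (L : int -> nat -> T -> R).
Variable lambda : R.
Hypotheses (mD : forall n, measurable_fun setT (D n))
  (mL : forall n i, measurable_fun setT (L n i))
  (D_gt0 : forall n w, 0 < D n w)
  (hD : iid_variables P D)
  (hLn : forall n, iid_variables P (L n))
  (hL : iid_sequences P L)
  (hLD : independent_families P (fun p : int * nat => L p.1 p.2) D)
  (lambda_gt0 : 0 < lambda)
  (hexp : forall x : R, 0 <= x ->
     P [set w | L 0 0%N w <= x] = (1 - expR (- (lambda * x)))%:E).

Local Notation pr A := (fine (P A)).
Local Notation survival t := (expR (- (lambda * t))).
Local Notation sigmaD := (sigma_generated D).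
Local Notation sigmaL := (sigma_generated (fun p : int * nat => L p.1 p.2)).

Lemma mark_le k i (x : R) : 0 <= x ->
  P [set w | L k i w <= x] = (1 - survival x)%:E.
Proof.
move=> x0; rewrite -hexp//.
have := (hLn k).2 i 0%N [set` `]-oo, x]] (measurable_itv _).
rewrite !preimage_itvNyc => ->.
exact: (hL.2 k 0 _ (@sigma_generated_le _ _ _
  (fun (j : nat) (f : nat -> R) => f j) 0%N x)).
Qed.

Lemma mark_gt k i (x : R) : 0 <= x -> P [set w | x < L k i w] = (survival x)%:E.
Proof.
move=> x0.
have -> : [set w | x < L k i w] = ~` [set w | L k i w <= x].
  by apply/seteqP; split => w /=; rewrite ltNge => /negP.
rewrite probability_setC ?mark_le//; first by rewrite -EFinB; congr EFin; ring.
apply: (sigma_generated_measurable (Y := L k)) => //.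
exact: sigma_generated_le.
Qed.

Definition first_above k (s t : R) i :=
  [set w | (forall j, (j < i)%N -> L k j w <= s) /\ t < L k i w].

Lemma prob_first_above k (s t : R) i : 0 <= s -> 0 <= t ->
  P (first_above k s t i) = ((1 - survival s) ^+ i * survival t)%:E.
Proof.
move=> s0 t0.
pose A j := if (j < i)%N then [set w | L k j w <= s] else [set w | t < L k j w].
rewrite (_ : first_above k s t i = \bigcap_(j in [set` iota 0 i.+1]) A j).
  rewrite (@independent_systems_seq _ _ _ P _ _ _ _ (hLn k).1) ?iota_uniq//.
    rewrite -{1}addn1 iotaD big_cat/= big_seq1 add0n /A ltnn mark_gt// EFinM.
    congr (_ * _)%E; rewrite (_ : iota 0 i = index_iota 0 i) ?big_mkord; last first.
      by rewrite /index_iota subn0.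
    under eq_bigr => j _ do rewrite ltn_ord mark_le//.
    by rewrite prodEFin prodr_const card_ord.
  move=> j _; rewrite /A; case: ifP => _.
    exact: preimage_set_system_le.
  exact: preimage_set_system_gt.
apply/seteqP; split => w.
  move=> [Ls Lt] j; rewrite /mkset mem_iota add0n ltnS => /andP[_].
  rewrite leq_eqVlt => /predU1P[->|ji]; rewrite /A ?ltnn// ji/=.
  exact: Ls.
move=> h; have {}h j : (j <= i)%N -> A j w.
  by move=> ji; apply: h; rewrite /mkset mem_iota.
split=> [j ji|]; last by have := h i (leqnn _); rewrite /A ltnn.
by have := h j (ltnW ji); rewrite /A ji.
Qed.

Lemma sigmaL_le k i (x : R) : sigmaL [set w | L k i w <= x].
Proof.
exact: (@sigma_generated_le _ _ _ (fun p : int * nat => L p.1 p.2) (k, i)).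
Qed.

Lemma sigmaL_gt k i (x : R) : sigmaL [set w | x < L k i w].
Proof.
exact: (@sigma_generated_gt _ _ _ (fun p : int * nat => L p.1 p.2) (k, i)).
Qed.

Lemma sigmaL_first_above k s t i : sigmaL (first_above k s t i).
Proof.
rewrite (_ : first_above k s t i =
    (\bigcap_(j in `I_i) [set w | L k j w <= s]) `&` [set w | t < L k i w]) //.
rewrite sigma_generatedE; apply: measurableI; last exact: sigmaL_gt.
by apply: bigcap_measurableType => j _; exact: sigmaL_le.
Qed.

Lemma sigmaD_le n (x : R) : sigmaD [set w | D n w <= x].
Proof. exact: sigma_generated_le. Qed.

Lemma sigmaD_gt n (x : R) : sigmaD [set w | x < D n w].
Proof. exact: sigma_generated_gt. Qed.

Lemma measurable_sigmaD A : sigmaD A -> measurable A.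
Proof. exact: sigma_generated_measurable. Qed.

Lemma measurable_sigmaL A : sigmaL A -> measurable A.
Proof. by apply: sigma_generated_measurable => -[k i]; exact: mL. Qed.

Lemma prob_independent F G : sigmaD F -> sigmaL G ->
  P (F `&` G) = (P F * P G)%E.
Proof. by move=> sF sG; rewrite setIC hLD// muleC. Qed.

(** If l < D k <= l + 1 and the excess at k is at least t, then the first mark
longer than D k exceeds l + t, and the marks before it are at most l + 1. *)
Definition late_given k (l : nat) (t : R) :=
  \bigcup_i first_above k (l%:R + 1) (l%:R + t) i.

Lemma sigmaL_late_given k l t : sigmaL (late_given k l t).
Proof.
rewrite sigma_generatedE; apply: bigcupT_measurable => i.
exact: sigmaL_first_above.
Qed.

Lemma survival_le1 (t : R) : 0 <= t -> survival t <= 1.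
Proof. by move=> t0; rewrite -expR0 ler_expR oppr_le0 mulr_ge0// ltW. Qed.

(** With the same threshold l for all marks, memorylessness would give
e^(-lambda t) exactly; the threshold l + 1 for the marks before the first long one
costs a factor e^lambda, uniformly in l. *)
Lemma prob_late_given k l t : 0 <= t ->
  (P (late_given k l t) <= (expR lambda * survival t)%:E)%E.
Proof.
move=> t0.
have l0 : (0 : R) <= l%:R by [].
pose u i := ((1 - survival (l%:R + 1)) ^+ i * survival (l%:R + t) : R)%:E.
apply: (@le_trans _ _ (\sum_(i <oo) u i)%E).
  rewrite [leRHS](_ : _ =
      \sum_(i <oo) P (first_above k (l%:R + 1) (l%:R + t) i))%E; last first.
    by apply: eq_eseriesr => i _; rewrite prob_first_above ?addr_ge0.
  apply: measure_sigma_subadditive => //.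
  - by move=> i; apply: measurable_sigmaL; exact: sigmaL_first_above.
  - by apply: measurable_sigmaL; exact: sigmaL_late_given.
have q1 : survival (l%:R + 1) <= 1 by apply: survival_le1; exact: addr_ge0.
apply: nneseries_le_partial => [i|n].
  by rewrite lee_fin mulr_ge0 ?expR_ge0// exprn_ge0// subr_ge0.
rewrite sumEFin lee_fin.
under eq_bigr => i _.
  rewrite (_ : survival (l%:R + t) =
    survival (l%:R + 1) * (expR lambda * survival t)); last first.
    by rewrite -!expRD; congr expR; ring.
  over.
by apply: geometric_sum_le; rewrite ?expR_ge0 ?q1// mulr_ge0 ?expR_ge0.
Qed.

(** This event contains the event that the first mark longer than D k exceeds D k
by at least t, but is a disjoint union of intersections of a gap event with a mark
event. *)
Definition late k t :=
  \bigcup_l ([set w | l%:R < D k w <= l%:R + 1] `&` late_given k l t).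

Lemma sigmaD_slice k (l : nat) : sigmaD [set w | l%:R < D k w <= l%:R + 1].
Proof.
rewrite (_ : mkset _ = [set w | l%:R < D k w] `&` [set w | D k w <= l%:R + 1]).
  rewrite sigma_generatedE.
  by apply: measurableI; [exact: sigmaD_gt|exact: sigmaD_le].
by apply/seteqP; split => w /= => [/andP|[-> ->]].
Qed.

Lemma measurable_late k t : measurable (late k t).
Proof.
apply: bigcupT_measurable => l; apply: measurableI.
  by apply: measurable_sigmaD; exact: sigmaD_slice.
by apply: measurable_sigmaL; exact: sigmaL_late_given.
Qed.

(** On each slice the gap event and the mark event are independent, and the
probability of the latter has a bound that is the same for all slices; the slices
of F then add up to at most P F. *)
Lemma prob_late F k t : sigmaD F -> 0 <= t ->
  (P (F `&` late k t) <= (expR lambda * survival t)%:E * P F)%E.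
Proof.
move=> sF t0; have mF := measurable_sigmaD sF.
(* the slices of F on which D k lies between consecutive integers *)
pose S l := F `&` [set w | l%:R < D k w <= l%:R + 1].
have sS l : sigmaD (S l).
  rewrite sigma_generatedE; apply: measurableI; first exact: sF.
  exact: sigmaD_slice.
have mS l : measurable (S l) by exact: measurable_sigmaD.
have tS : trivIset setT S.
  apply/trivIsetP => i j _ _ ij; apply/seteqP; split => // w [].
  move=> [_ /= /andP[i1 i2]] [_ /= /andP[j1 j2]].
  have : (i%:R : R) < j%:R + 1 by lra.
  have : (j%:R : R) < i%:R + 1 by lra.
  rewrite !natr1 !ltr_nat !ltnS => ji ij'.
  by move: ij; rewrite eqn_leq ij' ji.
apply: (@le_trans _ _
  (\sum_(l <oo) (expR lambda * survival t)%:E * P (S l))%E).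
  apply: (@le_trans _ _ (\sum_(l <oo) P (S l `&` late_given k l t))%E).
    apply: measure_sigma_subadditive.
    - move=> l; apply: measurableI => //.
      by apply: measurable_sigmaL; exact: sigmaL_late_given.
    - by apply: measurableI => //; exact: measurable_late.
    - by move=> w [Fw [l _ [Dw lw]]]; exists l.
  apply: lee_nneseries => // l _.
  have := prob_independent (sS l) (sigmaL_late_given k l t).
  rewrite [X in P X = _]/= => ->; rewrite muleC.
  by apply: lee_wpmul2r => //; exact: prob_late_given.
rewrite nneseriesZl//; apply: lee_wpmul2l.
  by rewrite lee_fin mulr_ge0 ?expR_ge0.
rewrite -measure_semi_bigcup//; last exact: bigcupT_measurable.
by apply: le_measure; rewrite ?inE//; [exact: bigcupT_measurable|
  move=> w [l _ []]].
Qed.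

Definition never_above k :=
  \bigcup_l (\bigcap_i [set w | L k i w <= (l%:R : R)]).

Definition marks_le k (x : R) n :=
  \bigcap_(i in [set` iota 0 n]) [set w | L k i w <= x].

Lemma prob_marks_le k (x : R) n : 0 <= x -> P (marks_le k x n) =
  ((1 - survival x) ^+ n)%:E.
Proof.
move=> x0.
rewrite (@independent_systems_seq _ _ _ P _ _ _ _ (hLn k).1) ?iota_uniq//.
  under eq_bigr => i _ do rewrite mark_le//.
  by rewrite prodEFin big_const_seq count_predT size_iota iter_mulr_1.
by move=> j _; exact: preimage_set_system_le.
Qed.

(** Exponential marks are unbounded: the first n of them stay below l with
probability (1 - e^(-lambda l)) ^ n. *)
Lemma never_above_negligible k : P.-negligible (never_above k).
Proof.
apply: negligible_bigcup => l.
have mC : measurable (\bigcap_i [set w | L k i w <= (l%:R : R)]).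
  apply: bigcapT_measurable => i; apply: measurable_sigmaL.
  exact: sigmaL_le.
apply/negligibleP => //; apply/eqP; rewrite eq_le measure_ge0 andbT.
apply/lee_addgt0Pr => e e0; rewrite add0e.
have q01 : 0 <= 1 - survival (l%:R) < 1.
  by rewrite subr_ge0 survival_le1//= ltrBlDr ltrDl expR_gt0.
have [n qn] := exists_expr_lt q01 e0.
apply: (@le_trans _ _ ((1 - survival (l%:R)) ^+ n)%:E); last first.
  by rewrite lee_fin ltW.
rewrite -(@prob_marks_le k)//; apply: le_measure; rewrite ?inE//.
  apply: bigcap_measurableType => i _; apply: measurable_sigmaL.
  exact: sigmaL_le.
by move=> w h i _; exact: h.
Qed.

Lemma above_of_not_never k w : ~ never_above k w -> exists i, D k w < L k i w.
Proof.
move=> h; apply: contrapT => /forallNP Lle; apply: h.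
exists (Num.truncn (D k w)).+1 => // i _ /=.
have := Lle i; move/negP; rewrite -leNgt => /le_trans; apply.
by apply: ltW; exact: truncnS_gt.
Qed.

(** Here i is the index of the first mark that exceeds the gap. *)
Lemma late_of_marks k t i w : (forall j, (j < i)%N -> L k j w <= D k w) ->
  D k w + t <= L k i w -> late k t w.
Proof.
move=> Lj Li.
have [l lD] : exists l : nat, l%:R < D k w <= l%:R + 1.
  have exn : exists n : nat, D k w <= n%:R.
    by exists (Num.truncn (D k w)).+1; apply: ltW; exact: truncnS_gt.
  (* the least such n is not 0, since gaps are positive *)
  case: (ex_minnP exn) => -[|l] Dl lmin.
    by move: Dl; rewrite leNgt D_gt0.
  exists l; rewrite natr1 Dl andbT ltNge; apply/negP => /lmin.
  by rewrite ltnn.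
exists l => //; split => //=; move: lD => /andP[lD Dl].
exists i => //; split; last by lra.
by move=> j ji; apply: le_trans (Lj j ji) _.
Qed.

Definition long_prob := pr [set w | 1 < D 0 w].

(** The expectation of e^(-lambda) to the power of the indicator of a long gap. *)
Definition decay := long_prob * survival 1 + (1 - long_prob).

(** J is the set of long gaps among the n gaps that follow the gap of k. *)
Definition pattern k n (J : {set 'I_n}) := \bigcap_(i in [set` enum 'I_n])
  if i \in J then [set w | 1 < D (k + 1 + (val i)%:Z) w]
  else [set w | D (k + 1 + (val i)%:Z) w <= 1].

Lemma sigmaD_pattern k n (J : {set 'I_n}) : sigmaD (pattern k J).
Proof.
rewrite sigma_generatedE; apply: fin_bigcap_measurable => [|i _].
  exact: finite_seq.
by case: ifP => _; [exact: sigmaD_gt|exact: sigmaD_le].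
Qed.

Lemma prob_gap_gt m (x : R) :
  P [set w | x < D m w] = (pr [set w | x < D 0 w])%:E.
Proof.
have := hD.2 m 0 [set` `]x, +oo[] (measurable_itv _).
rewrite !preimage_itvoy => ->.
by rewrite fineK// fin_num_measure//; apply: measurable_sigmaD; exact: sigmaD_gt.
Qed.

Lemma prob_gap_le m (x : R) :
  P [set w | D m w <= x] = (1 - pr [set w | x < D 0 w])%:E.
Proof.
have -> : [set w | D m w <= x] = ~` [set w | x < D m w].
  by apply/seteqP; split => w /=; rewrite leNgt => /negP.
rewrite probability_setC; last by apply: measurable_sigmaD; exact: sigmaD_gt.
by rewrite prob_gap_gt EFinB.
Qed.

Lemma prob_pattern k n (J : {set 'I_n}) : P (pattern k J) =
  (\prod_(i < n) if i \in J then long_prob else 1 - long_prob)%:E.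
Proof.
rewrite (@independent_systems_inj _ _ _ P _ _ _ _
  (fun i : 'I_n => k + 1 + (val i)%:Z) _ hD.1) ?enum_uniq//.
- rewrite big_enum/= -prodEFin; apply: eq_bigr => i _.
  by case: ifP => _; [exact: prob_gap_gt|exact: prob_gap_le].
- by move=> i j /addrI [] /val_inj.
- move=> i _; case: ifP => _; first exact: preimage_set_system_gt.
  exact: preimage_set_system_le.
Qed.

(** A jump of k over k + n requires an excess of at least the sum of the n gaps
D (k+1), .., D (k+n), hence of at least the number of long gaps among them. *)
Definition jump k n := \bigcup_(J in [set` enum {set 'I_n}])
  (pattern k J `&` late k (#|J|%:R : R)).

Lemma measurable_jump k n : measurable (jump k n).
Proof.
rewrite /jump bigcup_seq; apply: bigsetU_measurable => J _.
apply: measurableI; last exact: measurable_late.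
by apply: measurable_sigmaD; exact: sigmaD_pattern.
Qed.

(** The sum over J of the products of long_prob * e^(-lambda) over J and of
1 - long_prob outside J is the expansion of decay ^ n. *)
Lemma prob_jump k n : (P (jump k n) <= (expR lambda * decay ^+ n)%:E)%E.
Proof.
apply: le_trans.
  apply: measure_bigcup_seq_le => J; apply: measurableI.
    by apply: measurable_sigmaD; exact: sigmaD_pattern.
  exact: measurable_late.
rewrite big_enum/=.
apply: (@le_trans _ _ (\sum_(J : {set 'I_n})
  (expR lambda * survival #|J|%:R)%:E * P (pattern k J))%E).
  by apply: lee_sum => J _; apply: prob_late => //; exact: sigmaD_pattern.
under eq_bigr => J _ do rewrite prob_pattern -EFinM.
rewrite sumEFin lee_fin.
under eq_bigr => J _ do rewrite -mulrA.
rewrite -mulr_sumr ler_wpM2l ?expR_ge0//.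
have -> : decay ^+ n =
    \prod_(i < n) (long_prob * survival 1 + (1 - long_prob)).
  by rewrite prodr_const card_ord.
rewrite bigA_distr; apply: ler_sum => J _.
have -> : survival #|J|%:R = \prod_(i < n) if i \in J then survival 1 else 1.
  rewrite -big_mkcond prodr_const -expRM_natl; congr expR.
  by rewrite mulr1 mulrN mulrC.
rewrite -big_split/= le_eqVlt; apply/orP; left; apply/eqP/eq_bigr => i _.
by case: ifP => _; rewrite ?mul1r// mulrC.
Qed.

(** Here i is the index of the first mark that exceeds the gap. *)
Lemma jump_of_marks k n i w : (forall j, (j < i)%N -> L k j w <= D k w) ->
  D k w + \sum_(j < n) D (k + 1 + (val j)%:Z) w <= L k i w -> jump k n w.
Proof.
move=> Lj Li; pose J := finset (fun j : 'I_n => 1 < D (k + 1 + (val j)%:Z) w).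
exists J; first by rewrite /mkset mem_enum.
split.
  by move=> j _ /=; rewrite inE; case: ltP.
apply: (late_of_marks Lj); apply: le_trans Li; rewrite lerD2l.
rewrite -sum1_card natr_sum big_mkcond/=; apply: ler_sum => j _.
by rewrite inE; case: ifP => [/ltW//|_]; exact: ltW.
Qed.

(** * Blocks whose last point is not jumped over *)

Lemma sigmaL_single k A : sigma_generated (L k) A -> sigmaL A.
Proof.
apply: smallest_sub; first exact: smallest_sigma_algebra.
move=> _ [i _ [B mB <-]]; apply: sub_sigma_algebra.
by exists (k, i) => //; exists B.
Qed.

Lemma sigma_generated_marks_le k (x : R) n :
  sigma_generated (L k) (marks_le k x n).
Proof.
rewrite sigma_generatedE; apply: bigcap_measurableType => i _.
exact: sigma_generated_le.
Qed.

(** Intersecting first all gap events and then all mark events, independence of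
gaps and marks yields two factors, and each of them factorizes further by
independence within its family. *)
Lemma prob_rectangles (M : int) (DE LE : nat -> set T) (s : seq nat) :
  (forall i, preimage_set_system setT (D (M + i%:Z)) measurable (DE i)) ->
  (forall i, sigma_generated (L (M + i%:Z)) (LE i)) -> uniq s ->
  P (\bigcap_(i in [set` s]) (DE i `&` LE i)) =
  (\prod_(i <- s) (P (DE i) * P (LE i)))%E.
Proof.
move=> hDE hLE us.
have inj_shift : injective (fun i : nat => M + i%:Z) by move=> i j /addrI [].
have -> : \bigcap_(i in [set` s]) (DE i `&` LE i) =
    \bigcap_(i in [set` s]) DE i `&` \bigcap_(i in [set` s]) LE i.
  exact: bigcapI.
rewrite big_split/=.
rewrite -(independent_systems_inj hD.1 us inj_shift); last by move=> i _.
rewrite -(independent_systems_inj hL.1 us inj_shift); last by move=> i _.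
apply: prob_independent; rewrite sigma_generatedE.
  apply: bigcap_measurableType => i _; have [B mB <-] := hDE i.
  by rewrite setTI; exact: sigma_generated_preimage.
by apply: bigcap_measurableType => i _; exact: (sigmaL_single (hLE i)).
Qed.

(** No k before m jumps over m; the index i of the first mark that exceeds the gap
is quantified, which avoids the default values of tau. *)
Definition unjumped w m := forall k i, k < m ->
  (forall j, (j < i)%N -> L k j w <= D k w) -> D k w < L k i w ->
  L k i w < D k w + \sum_(j < `|m - k|) D (k + 1 + (val j)%:Z) w.

Section trials.
Variables (M : int) (a c : R) (n r : nat).
Hypotheses (a0 : 0 <= a) (ac : a <= c).

(** Together with D k <= a, this makes some of the first n marks exceed the gap,
and the first one to do so is then at most c. *)
Definition calm_marks k := marks_le k c n `\` marks_le k a n.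

Definition calm_prob :=
  (1 - pr [set w | a < D 0 w]) * ((1 - survival c) ^+ n - (1 - survival a) ^+ n).

Lemma prob_calm_marks k :
  P (calm_marks k) = ((1 - survival c) ^+ n - (1 - survival a) ^+ n)%:E.
Proof.
have mm x : measurable (marks_le k x n).
  by apply: measurable_sigmaL; apply: sigmaL_single;
    exact: sigma_generated_marks_le.
have mI : marks_le k c n `&` marks_le k a n = marks_le k a n.
  by apply/setIidPr => w h i si; apply: le_trans (h i si) ac.
apply: (etrans (measureD (mm c) (mm a) _)).
  by rewrite ltey_eq fin_num_measure.
rewrite [X in (_ - P X)%E]mI EFinB; congr (_ - _)%E; apply: prob_marks_le => //.
exact: le_trans ac.
Qed.

(** Indices count from M. They are cut into blocks of r+1, and the last index of
a block is the candidate for not being jumped over. *)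
Definition block_last (i : nat) := (i %% r.+1 == r)%N.

Definition trial_gap i := if block_last i then [set w | c < D (M + i%:Z) w]
  else [set w | D (M + i%:Z) w <= a].

Definition trial_marks i := if block_last i then setT else calm_marks (M + i%:Z).

Definition trial_event i := trial_gap i `&` trial_marks i.

Definition trial_prob i := if block_last i then pr [set w | c < D 0 w] else calm_prob.

Lemma trial_gap_preimage i :
  preimage_set_system setT (D (M + i%:Z)) measurable (trial_gap i).
Proof.
rewrite /trial_gap; case: ifP => _; first exact: preimage_set_system_gt.
exact: preimage_set_system_le.
Qed.

Lemma trial_marks_generated i :
  sigma_generated (L (M + i%:Z)) (trial_marks i).
Proof.
rewrite /trial_marks sigma_generatedE; case: ifP => _.
  exact: measurableT.
by apply: measurableD; exact: sigma_generated_marks_le.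
Qed.

Lemma measurable_trial_event i : measurable (trial_event i).
Proof.
apply: measurableI.
  have [B mB <-] := trial_gap_preimage i.
  by rewrite -[_ `&` _]/(setT `&` _); apply: mD.
exact: (measurable_sigmaL (sigmaL_single (@trial_marks_generated i))).
Qed.

Lemma prob_trial_events (s : seq nat) : uniq s ->
  P (\bigcap_(i in [set` s]) trial_event i) = (\prod_(i <- s) trial_prob i)%:E.
Proof.
move=> us; apply: (etrans (prob_rectangles trial_gap_preimage
  (@trial_marks_generated) us)).
rewrite -prodEFin; apply: eq_bigr => i _.
rewrite /trial_gap /trial_marks /trial_prob; case: ifP => _.
  by rewrite probability_setT mule1; exact: prob_gap_gt.
by rewrite /calm_prob EFinM; congr (_ * _)%E;
  [exact: prob_gap_le|exact: prob_calm_marks].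
Qed.

Lemma trial_block_prob j : \prod_(i <- iota (j * r.+1) r.+1) trial_prob i =
  pr [set w | c < D 0 w] * calm_prob ^+ r.
Proof.
rewrite -[(j * r.+1)%N]addn0 iotaDl big_map -addn1 iotaD big_cat/= big_seq1.
rewrite /trial_prob /block_last add0n addn1 modnMDl modn_small// eqxx mulrC.
congr (_ * _); rewrite big_seq.
under eq_bigr => i.
  rewrite mem_iota add0n => /andP[_ ir].
  rewrite modnMDl modn_small ?(ltnW ir)//; last exact: ltnW.
  rewrite ltn_eqF//; over.
by rewrite -big_seq big_const_seq count_predT size_iota iter_mulr_1.
Qed.

Definition block j := \bigcap_(i in [set` iota (j * r.+1) r.+1]) trial_event i.

Definition block_end j := M + (j * r.+1 + r)%:Z.

(** The points before the block, that is at distance r+1 or more from its end, are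
the ones that the event block does not control. *)
Definition jumped_from_afar j :=
  \bigcup_i jump (block_end j - (r.+1 + i)%:Z) (r.+1 + i).

Definition failure N := \bigcap_(j in `I_N) ~` block j `|`
  \bigcup_(j in [set` iota 0 N]) jumped_from_afar j.

Lemma block_last_in_block j i : (i <= r)%N -> block_last (j * r.+1 + i) = (i == r).
Proof. by move=> ir; rewrite /block_last modnMDl modn_small. Qed.

(** A point k outside the block would jump from afar. For a point k inside, the
first mark that exceeds the gap is at most c, less than the last gap of the block. *)
Lemma unjumped_block_end w j :
  block j w -> ~ jumped_from_afar j w -> unjumped w (block_end j).
Proof.
set m := block_end j => Bw Jw k i km Lj Li; set g := `|m - k|%N.
have kE : k = m - g%:Z by rewrite /g; lia.
have [gr|rg] := leqP g r; last first.
  rewrite ltNge; apply/negP => Lge; apply: Jw; exists (g - r.+1)%N => //.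
  by rewrite subnKC// -/m -kE; exact: jump_of_marks Lge.
have g0 : (0 < g)%N by rewrite /g; lia.
have Bi h : (h <= r)%N -> trial_event (j * r.+1 + h) w.
  move=> hr; apply: Bw; rewrite /mkset mem_iota leq_addr/=.
  by rewrite -addnS leq_add2l.
have [Dm _] := Bi r (leqnn _).
rewrite /trial_gap block_last_in_block// eqxx /= -/(block_end j) -/m in Dm.
have [] := Bi (r - g)%N (leq_subr _ _).
rewrite /trial_gap /trial_marks block_last_in_block ?leq_subr// ltn_eqF; last first.
  by rewrite ltn_subrL g0 (leq_trans g0).
have -> : M + (j * r.+1 + (r - g))%:Z = k by rewrite kE /m /block_end; lia.
move=> /= Da [Lc La].
(* otherwise the first n marks are at most D k, hence at most a *)
have iN : (i < n)%N.
  rewrite ltnNge; apply/negP => ni; apply: La => h.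
  rewrite /mkset mem_iota add0n => /andP[_ hn] /=.
  by apply: le_trans Da; apply: Lj; exact: leq_trans ni.
have Lic : L k i w <= c by apply: Lc; rewrite /mkset mem_iota.
apply: (le_lt_trans Lic); apply: (lt_le_trans Dm).
rewrite -[leLHS]add0r lerD//; first exact: ltW.
move: g0 kE; case: (g) => // g' _ kE.
rewrite big_ord_recr/= (_ : k + 1 + g'%:Z = m); last by lia.
by rewrite lerDr sumr_ge0// => h _; exact: ltW.
Qed.

End trials.

Lemma gap_tail_le1 (x : R) : pr [set w | x < D 0 w] <= 1.
Proof.
rewrite -lee_fin -(prob_gap_gt 0) probability_le1//.
by apply: measurable_sigmaD; exact: sigmaD_gt.
Qed.

Lemma decay_ge0 : 0 <= decay.
Proof.
rewrite addr_ge0 ?subr_ge0 ?gap_tail_le1//.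
by rewrite mulr_ge0 ?expR_ge0// fine_ge0.
Qed.

Section infinitely_many.
Hypothesis D_unbounded : forall x : R, (0 < P [set w | (x < D 0 w)%R])%E.

Lemma gap_tail_gt0 (x : R) : 0 < pr [set w | x < D 0 w].
Proof. by rewrite -lte_fin -(prob_gap_gt 0). Qed.

Lemma decay_lt1 : decay < 1.
Proof.
have p0 : 0 < long_prob := gap_tail_gt0 1.
have : survival 1 < 1 by rewrite -[ltRHS]expR0 ltr_expR oppr_lt0 mulr1.
move=> s1; have : long_prob * survival 1 < long_prob * 1 by rewrite ltr_pM2l.
by rewrite /decay; lra.
Qed.

Lemma gap_tail_small (e : R) : 0 < e ->
  exists2 a : R, 0 <= a & pr [set w | a < D 0 w] <= e.
Proof.
move=> e0; pose A (n : nat) := [set w | D 0 w <= n%:R].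
have mA n : measurable (A n) by apply: measurable_sigmaD; exact: sigmaD_le.
have AT : \bigcup_n A n = setT.
  apply/seteqP; split => // w _; exists (Num.truncn (D 0 w)).+1 => //=.
  by apply: ltW; exact: truncnS_gt.
have ndA : nondecreasing_seq A.
  move=> i j ij; apply/subsetPset => w /= /le_trans; apply.
  by rewrite ler_nat.
have : (fun n => P (A n)) @ \oo --> 1%:E.
  rewrite -(probability_setT P) -AT.
  by apply: nondecreasing_cvg_mu => //; exact: bigcupT_measurable.
move=> /fine_cvgP[_ /cvgrPdist_le/(_ e e0)[n _ /(_ n (leqnn _))]] /= h.
exists n%:R => //; move: h; rewrite /comp/= prob_gap_le/=.
by rewrite opprB addrC subrK => /(le_trans (ler_norm _)).
Qed.

(** The thresholds are chosen in turn: a so that the gap is at most a with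
probability close to 1, then n so that one of n marks very likely exceeds a, and
finally c so that these n marks are very likely at most c. *)
Lemma exists_calm : exists a c n,
  [/\ 0 <= a, a <= c & decay < calm_prob a c n <= 1].
Proof.
have d0 := decay_ge0; have d1 := decay_lt1.
(* each of the three probabilities may lose e: (1 - e) * (1 - 2 * e) > 1 - 4 * e *)
pose e := (1 - decay) / 4; have e0 : 0 < e by rewrite /e; lra.
have [a a0 ha] := gap_tail_small e0.
have sa1 := survival_le1 a0; have sa0 := expR_gt0 (- (lambda * a)).
have q01 : 0 <= 1 - survival a < 1 by rewrite subr_ge0 sa1/=; lra.
have [n hn] := exists_expr_lt q01 e0.
have s101 : 0 <= survival 1 < 1.
  by rewrite expR_ge0 -[ltRHS]expR0 ltr_expR oppr_lt0 mulr1.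
have en0 : 0 < e / n.+1%:R by rewrite divr_gt0.
have [j hj] := exists_expr_lt s101 en0.
pose c := a + j%:R; have ac : a <= c by rewrite lerDl.
have c0 : 0 <= c by exact: le_trans ac.
have sc1 := survival_le1 c0; have sc0 := expR_gt0 (- (lambda * c)).
have scj : survival c <= survival 1 ^+ j.
  rewrite -expRM_natl ler_expR mulr1 /c mulrN lerN2 mulrC.
  by rewrite ler_wpM2l ?(ltW lambda_gt0)// lerDr.
have hc : 1 - e <= (1 - survival c) ^+ n.
  apply: le_trans (expr_onem_ge n _); last by rewrite ltW.
  rewrite lerD2l lerN2; apply: (@le_trans _ _ (n.+1%:R * (e / n.+1%:R))).
    by apply: ler_pM; rewrite ?ler_nat ?(ltW sc0)// (le_trans scj)// ltW.
  by rewrite mulrC divfK.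
have hc1 : (1 - survival c) ^+ n <= 1 by rewrite exprn_ile1//; lra.
have ha0 : 0 <= (1 - survival a) ^+ n by rewrite exprn_ge0//; lra.
have t0 := gap_tail_gt0 a; have t1 := gap_tail_le1 a.
exists a, c, n; split => //; rewrite /calm_prob.
set t := fine _ in ha t0 t1 *.
set u := (1 - survival c) ^+ n in hc hc1 *.
set v := (1 - survival a) ^+ n in hn ha0 *.
have e4 : decay = 1 - 4 * e by rewrite /e; lra.
apply/andP; split; last by nra.
have : (1 - e) * (1 - 2 * e) <= (1 - t) * (u - v).
  by apply: ler_pM; rewrite /e; lra.
have : 0 <= e * e by rewrite mulr_ge0// ltW.
lra.
Qed.

Section failure_bound.
Variables (M : int) (a c : R) (n r : nat).
Hypotheses (a0 : 0 <= a) (ac : a <= c).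

Lemma measurable_jumped_from_afar j : measurable (jumped_from_afar M r j).
Proof. by apply: bigcupT_measurable => i; exact: measurable_jump. Qed.

Lemma prob_jumped_from_afar j : (P (jumped_from_afar M r j) <=
  (expR lambda / (1 - decay) * decay ^+ r)%:E)%E.
Proof.
have d0 := decay_ge0; have d1 := decay_lt1.
have d1' : 0 < 1 - decay by rewrite subr_gt0.
pose K := expR lambda / (1 - decay) * decay ^+ r.
have K0 : 0 <= K by rewrite mulr_ge0 ?exprn_ge0// divr_ge0 ?expR_ge0// ltW.
pose u i := ((1 - (1 - decay)) ^+ i * ((1 - decay) * K))%:E.
apply: (@le_trans _ _ (\sum_(i <oo) u i)%E); last first.
  apply: nneseries_le_partial => [i|N].
    rewrite lee_fin; apply: mulr_ge0; first by rewrite exprn_ge0//; lra.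
    by rewrite mulr_ge0// ltW.
  rewrite sumEFin lee_fin; apply: geometric_sum_le => //.
  by rewrite ltW//=; lra.
apply: (@le_trans _ _ (\sum_(i <oo)
    P (jump (block_end M r j - (r.+1 + i)%:Z) (r.+1 + i)))%E).
  apply: measure_sigma_subadditive => //; first by move=> i; exact: measurable_jump.
  exact: measurable_jumped_from_afar.
apply: lee_nneseries => // i _; apply: (le_trans (prob_jump _ _)).
rewrite lee_fin /K (_ : 1 - (1 - decay) = decay); last by lra.
rewrite (_ : _ * (_ * _) = expR lambda * decay ^+ (r + i)); last first.
  by rewrite exprD; field; rewrite gt_eqF.
by rewrite ler_wpM2l ?expR_ge0// addSn exprS ler_piMl ?exprn_ge0// ltW.
Qed.

Lemma measurable_block j : measurable (block M a c n r j).
Proof.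
by apply: bigcap_measurableType => i _; exact: measurable_trial_event.
Qed.

Lemma measurable_failure N : measurable (failure M a c n r N).
Proof.
apply: measurableU.
  by apply: bigcap_measurableType => j _; apply: measurableC; exact: measurable_block.
by apply: bigcup_measurable => j _; exact: measurable_jumped_from_afar.
Qed.

(** The first term bounds the failure of all blocks, which are independent, and
the second one is a union bound over the blocks. *)
Lemma prob_failure N : (P (failure M a c n r N) <=
  ((1 - pr [set w | (c < D 0 w)%R] * calm_prob a c n ^+ r) ^+ N +
   N%:R * (expR lambda / (1 - decay) * decay ^+ r))%:E)%E.
Proof.
have mN : measurable (\bigcap_(j in `I_N) ~` block M a c n r j).
  by apply: bigcap_measurableType => j _; apply: measurableC; exact: measurable_block.
apply: le_trans (measureU2 _ mN _) _.
  by apply: bigcup_measurable => j _; exact: measurable_jumped_from_afar.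
rewrite EFinD; apply: leeD.
  have := @prob_no_full_block _ _ _ P _ _ r.+1 N [::]
    (measurable_trial_event M a c n r) (prob_trial_events M n r a0 ac) isT.
  rewrite (_ : [set` [::]] = set0); last by apply/seteqP; split.
  rewrite bigcap_set0 setTI big_nil mul1r => noblock.
  rewrite le_eqVlt; apply/orP; left; apply/eqP; apply: (etrans (noblock _)) => //.
  under eq_bigr => j _ do rewrite trial_block_prob.
  by rewrite prodr_const card_ord.
apply: le_trans (measure_bigcup_seq_le _ _ _) _.
  exact: measurable_jumped_from_afar.
apply: le_trans (lee_sum _ (fun j _ => prob_jumped_from_afar j)) _.
rewrite sumEFin big_const_seq count_predT size_iota iter_addr_0.
by rewrite lee_fin mulr_natl.
Qed.

End failure_bound.

(** To the right of M, a success among the N blocks that is not spoilt from afar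
gives an unjumped point; the parameters make the failure as unlikely as
desired. *)
Lemma negligible_finitely_many_unjumped :
  P.-negligible [set w | exists M : nat, forall m, M%:Z <= m -> ~ unjumped w m].
Proof.
pose F (M : nat) := [set w | forall m, M%:Z <= m -> ~ unjumped w m].
apply: (@negligibleS _ _ _ _ (\bigcup_M F M)); first by move=> w [M hM]; exists M.
apply: negligible_bigcup => M; apply: negligible_small_covers => e e01.
have [a [c [n [a0 ac hw]]]] := exists_calm.
have q01 : 0 < pr [set w | c < D 0 w] <= 1.
  by rewrite gap_tail_gt0 gap_tail_le1.
have C0 : 0 <= expR lambda / (1 - decay).
  by rewrite divr_ge0 ?expR_ge0// subr_ge0 ltW// decay_lt1.
have [r [N hN]] := exists_trials decay_ge0 hw q01 C0 e01.
exists (failure M%:Z a c n r N); split.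
- exact: measurable_failure.
- by apply: le_trans (prob_failure _ _ _ a0 ac _) _; rewrite lee_fin.
- move=> w Fw; have [[j jN Bj]|noblock] :=
    pselect (exists2 j, (j < N)%N & block M%:Z a c n r j w); last first.
    by left => j jN Bj; apply: noblock; exists j.
  right; exists j; first by rewrite /mkset mem_iota.
  apply: contrapT => nJ; apply: (Fw (block_end M%:Z r j)).
    by rewrite lerDl.
  exact: unjumped_block_end Bj nJ.
Qed.

End infinitely_many.

End marked.

(** * Infinitely many universal checkpoints *)

Lemma right_unbounded_support_gt_gt0 {d : measure_display}
    {T : measurableType d} {R : realType} (P : probability T R) (Y : T -> R)
    (x : R) : measurable_fun setT Y -> right_unbounded_support P Y ->
  (0 < P [set w | (x < Y w)%R])%E.
Proof.
move=> mY unbY.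
have mYx (I : interval R) : measurable (Y @^-1` [set` I]).
  by rewrite -[_ @^-1` _]setTI; apply: mY => //; exact: measurable_itv.
have [y Yy xy] : exists2 y, law_support P Y y & x < y.
  apply: contrapT => noy; apply: unbY; exists x => y Yy.
  by rewrite leNgt; apply/negP => xy; apply: noy; exists y.
have yx0 : 0 < y - x by rewrite subr_gt0.
apply: (lt_le_trans (Yy _ yx0)); apply: le_measure; rewrite ?inE.
- rewrite (_ : mkset _ = Y @^-1` [set` `]y - (y - x), y + (y - x)[]) //.
  by apply/seteqP; split => w /=; rewrite in_itv/= -ltr_distlC distrC.
- by rewrite -preimage_itvoy.
- by move=> w /=; rewrite ltr_norml => /andP[+ _]; lra.
Qed.

Lemma sum_gap {R : realType} (x : int -> R) (k : int) n :
  \sum_(j < n) gap x (k + (val j)%:Z) = x (k + n%:Z) - x k.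
Proof.
elim: n => [|n IH]; first by rewrite big_ord0 addr0 subrr.
rewrite big_ord_recr/= IH /gap (_ : k + n%:Z + 1 = k + n.+1%:Z); last by lia.
ring.
Qed.

(** The sum of the gaps from k+1 to m telescopes to the distance between the points
k+1 and m+1. *)
Lemma universal_checkpoint_of_unjumped {d : measure_display}
    {T : measurableType d} {R : realType}
    (X : int -> T -> R) (L : int -> nat -> T -> R) (w : T) (m : int) :
  (forall n, X n w < X (n + 1) w) -> (forall M, exists n, M < X n w) ->
  (forall k, exists i, gap (X ^~ w) k < L k i w) ->
  unjumped (fun n w => gap (X ^~ w) n) L w m ->
  universal_checkpoint (X ^~ w) (fun n i => L n i w) m.
Proof.
move=> XS Xub above um; apply: universal_checkpoint_unjumped => // k km.
have [tau_gt tau_min] := @tauP _ _ (fun n i => L n i w) _ (above k).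
rewrite /excess ltrBlDl; apply: lt_le_trans (um _ _ km tau_min tau_gt) _.
rewrite lerD2l (sum_gap (X ^~ w)) (_ : k + 1 + `|m - k|%N%:Z = m + 1)//.
by lia.
Qed.

Lemma exists_increasing (Q : int -> Prop) :
  (forall M : nat, exists2 m, M%:Z <= m & Q m) ->
  exists u : nat -> int, {homo u : i j / (i < j)%N >-> i < j} /\ forall i, Q (u i).
Proof.
move=> Qfar.
have /choice[f hf] : forall M : nat, exists m, M%:Z <= m /\ Q m.
  by move=> M; have [m Mm Qm] := Qfar M; exists m.
pose u i := iter i (fun m => f `|m|.+1%N) (f 0%N).
exists u; split=> [|[|i]]; [|exact: (hf _).2|exact: (hf _).2].
apply: homo_ltn => [y x z|i]; first exact: lt_trans.
by rewrite /u iterS; have [] := hf `|u i|.+1%N; rewrite -/(u i); lia.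
Qed.

Theorem theorem20 (d : measure_display) (T : measurableType d) (R : realType)
    (P P0 : probability T R) (theta : R -> T -> T)
    (X : int -> T -> R) (L : int -> nat -> T -> R) (lambda : R)
    (hPhi : stationary_marked_point_process P theta X L)
    (hint : (0 < intensity P X < +oo)%E)
    (hP0 : is_palm_probability P theta X P0)
    (hD : iid_variables P0 (fun n w => gap (X ^~ w) n))
    (hLn : forall n : int, iid_variables P0 (L n))
    (hL : iid_sequences P0 L)
    (hLD : independent_families P0
             (fun p : int * nat => L p.1 p.2) (fun n w => gap (X ^~ w) n))
    (hDsupp : right_unbounded_support P0 (fun w => gap (X ^~ w) 0))
    (hLsupp : right_unbounded_support P0 (L 0 0%N))
    (hDint : P0.-integrable setT (fun w => (gap (X ^~ w) 0)%:E))
    (hLint : P0.-integrable setT (fun w => (L 0 0%N w)%:E))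
    (hlambda : 0 < lambda)
    (hexp : forall x : R, 0 <= x ->
       P0 [set w | L 0 0%N w <= x] = (1 - expR (- (lambda * x)))%:E)
    (hnu : (\int[P0]_w ((nu (X ^~ w) (fun n i => L n i w) 1)%:~R)%:E < +oo)%E) :
  {ae P0, forall w, exists u : nat -> int,
     {homo u : i j / (i < j)%N >-> i < j} /\
     forall i : nat,
       universal_checkpoint (X ^~ w) (fun n i => L n i w) (u i)}.
Proof.
pose D n w := gap (X ^~ w) n.
have mX := point_measurable hPhi.
have mD n : measurable_fun setT (D n) by apply: measurable_funB.
have D_gt0 n w : 0 < D n w by rewrite subr_gt0; exact: points_increasing hPhi _ _.
have D_unbounded (x : R) : (0 < P0 [set w | (x < D 0 w)%R])%E.
  exact: right_unbounded_support_gt_gt0.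
have hLDR : independent_families P0 (fun p : int * nat => L p.1 p.2) D by [].
have finitely_many := negligible_finitely_many_unjumped mD
  (mark_measurable hPhi) D_gt0 hD hLn hL hLDR hlambda hexp D_unbounded.
have never k := never_above_negligible (mark_measurable hPhi) hLn hL hlambda
  hexp k.
apply: (negligibleS _ (negligibleU finitely_many (negligibleU
  (negligible_bigcup (fun n : nat => never n%:Z))
  (negligible_bigcup (fun n : nat => never (- n%:Z)))))).
move=> w; apply: contra_notP => /not_orP[far /not_orP[above_pos above_neg]].
have above k : exists i, D k w < L k i w.
  apply: above_of_not_never => nk; case: (intP k) nk => [|n|n] nk.
  - by apply: above_pos; exists 0%N.
  - by apply: above_pos; exists n.+1.
  - by apply: above_neg; exists n.+1.
apply: exists_increasing => M; apply: contrapT => noM; apply: far; exists M.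
move=> m Mm um; apply: noM; exists m => //.
apply: universal_checkpoint_of_unjumped => //.
- by move=> n; exact: points_increasing hPhi _ _.
- by move=> y; case: (points_unbounded hPhi w y).
Qed.
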